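(* Let $M$ be a square matrix of order $n$ and let $\lambda$ be a partition of $n$. If $M$ contains a $y\times z$ zero submatrix with $y+z=n+1$, then $\operatorname{Imm}_{\lambda}(M)=0$.
   Context: Matrices have complex entries. For a partition $\lambda$ of $n$, $\chi_\lambda$ is the irreducible character of the symmetric group $\mathcal{S}_n$ indexed by $\lambda$, and $\operatorname{Imm}_\lambda(M)=\sum_{\sigma\in\mathcal{S}_n}\chi_\lambda(\sigma)\prod_{i=1}^n m_{i\sigma(i)}$ for an $n\times n$ matrix $M=[m_{ij}]$. A $y\times z$ zero submatrix means a set of $y$ rows and a set of $z$ columns (not necessarily consecutive) such that all entries of $M$ at their intersections are $0$. *)

(* Defs.v *)
From HB Require Import structures.
From mathcomp Require Import all_boot all_order all_fingroup all_algebra.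
From mathcomp Require Import all_solvable all_field all_character.
From mathcomp Require Import reals.
From mathcomp Require Import complex.

Set Implicit Arguments.
Unset Strict Implicit.
Unset Printing Implicit Defensive.

Import GRing.Theory.
Local Open Scope ring_scope.

Definition is_partition (n : nat) (lam : seq nat) : bool :=
  [&& sorted geq lam, 0%N \notin lam & sumn lam == n].

(* For lam a partition of n, cell (r, c) of the diagram of lam is labelled by
   the i : 'I_n with reshape_index lam i = r and reshape_offset lam i = c, i.e.
   0, 1, ..., n - 1 are written in the diagram row after row. The two sets
   below are the row and the column group of this tableau. *)
Definition row_stab (n : nat) (lam : seq nat) : {set 'S_n} :=
  [set s : 'S_n | [forall i, reshape_index lam (s i) == reshape_index lam i]].

Definition col_stab (n : nat) (lam : seq nat) : {set 'S_n} :=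
  [set s : 'S_n | [forall i, reshape_offset lam (s i) == reshape_offset lam i]].

Section SpechtModule.

Variables (F : fieldType) (n : nat) (lam : seq nat).

(* The group algebra F[S_n] as a right module over itself, on row vectors. *)
Definition sym_reg : mx_representation F [set: 'S_n]%G #|[set: 'S_n]%G| :=
  regular_repr F [set: 'S_n]%G.

(* As a row vector of coordinates, the Young symmetrizer
   (\sum_(p in row_stab) p) * (\sum_(q in col_stab) sgn(q) q). *)
Definition young_symmetrizer : 'rV[F]_#|[set: 'S_n]%G| :=
  gring_row ((\sum_(p in row_stab n lam) sym_reg p) *m
             (\sum_(q in col_stab n lam) (-1) ^+ q *: sym_reg q)).

(* The right ideal of F[S_n] generated by the Young symmetrizer; when F has
   characteristic 0 it is the irreducible S_n-module indexed by lam. *)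
Definition specht_repr :
    mx_representation F [set: 'S_n]%G
      (\rank (cyclic_mx sym_reg young_symmetrizer)) :=
  submod_repr (cyclic_mx_module sym_reg young_symmetrizer).

Definition sym_char (s : 'S_n) : F := \tr (specht_repr s).

End SpechtModule.

Definition immanant (F : fieldType) (n : nat) (lam : seq nat) (M : 'M[F]_n) : F :=
  \sum_(s : 'S_n) sym_char F lam s * \prod_(i < n) M i (s i).

Definition has_zero_submx (F : fieldType) (n : nat) (M : 'M[F]_n)
    (y z : nat) : Prop :=
  exists Y Z : {set 'I_n},
    [/\ #|Y| = y, #|Z| = z & forall i j, i \in Y -> j \in Z -> M i j = 0].

(* Main.v *)
Require Import Defs.
From mathcomp Require Import all_boot all_order all_fingroup all_algebra.
From mathcomp Require Import reals complex.

(** This is the easy half of the Frobenius-König theorem.  If the rows [Y] and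
    the columns [Z] carry a zero block with [#|Y| + #|Z| > n], then no
    permutation [s] can keep [s @: Y] disjoint from [Z], by counting in ['I_n];
    hence every diagonal product [\prod_i M i (s i)] meets the block and
    vanishes.  An immanant is a linear combination of these products. *)

Local Open Scope ring_scope.
Local Open Scope complex_scope.

(** As [s] is injective, [s @: Y] has the size of [Y], so [s @: Y] and [Z]
    cannot both fit disjointly in [T]. *)
Lemma perm_meets_large (T : finType) (Y Z : {set T}) (s : {perm T}) :
  (#|T| < #|Y| + #|Z|)%N -> exists2 i, i \in Y & s i \in Z.
Proof.
move=> large; have [/eqP disj | [j]] := set_0Vmem (s @: Y :&: Z); last first.
  by case/setIP=> /imsetP[i Yi ->] Zsi; exists i.
have := leq_card_setU (s @: Y) Z; rewrite setI_eq0 in disj.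
case=> _; rewrite disj => /eqP cardU.
have := max_card (mem (s @: Y :|: Z)).
by rewrite cardU (card_imset _ (@perm_inj _ s)) leqNgt large.
Qed.

Lemma diag_prod_zero_submx (F : fieldType) (n y z : nat) (M : 'M[F]_n)
    (s : 'S_n) :
  has_zero_submx M y z -> (n < y + z)%N -> \prod_(i < n) M i (s i) = 0.
Proof.
case=> Y [Z [<- <- M0]] large.
have [|i Yi Zsi] := @perm_meets_large _ Y Z s; first by rewrite card_ord.
by rewrite (bigD1 i) //= M0 // GRing.mul0r.
Qed.

Theorem theorem5p1 (R : realType) (n : nat) (M : 'M[R[i]]_n) (lam : seq nat)
    (y z : nat) :
  is_partition n lam ->
  has_zero_submx M y z ->
  (y + z = n + 1)%N ->
  immanant lam M = 0.
Proof.
move=> _ M0 yz; rewrite /immanant big1 // => s _.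
by rewrite (@diag_prod_zero_submx _ n y z M s M0) ?GRing.mulr0 // yz addn1.
Qed.
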